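(* Let $q\ge 0$ be an integer and let $T$ be a tree on $n\geq 2$ vertices. For $v\in V(T)$, let $h=h(T,v)$ be the height of $T$ rooted at $v$, and for each height $\ell$ let $L_\ell=L_\ell(v)$ be a set of at most $q$ vertices with the largest degrees at height $\ell$ (that is, $q$ vertices of largest degree in $T$ among the vertices at height $\ell$, or all vertices at height $\ell$ if there are fewer than $q$ of them). Then \[\operatorname{Z}_q(T)\leq \min_{v\in V(T)}\left\{\deg(v)+\sum_{\ell=1}^{h-1}\ \sum_{a\in L_\ell}\max\{0,\deg(a)-2\}\right\}.\]
   Context: Graphs are finite, simple and undirected. If $T$ is a tree rooted at $v$, a vertex $u$ is at height $i$ if its distance to $v$ is $i$; the height $h(T,v)$ of $T$ rooted at $v$ is the maximum height of any vertex of $T$. The $\operatorname{Z}_q$-forcing game ($q\ge 0$ an integer) is played on a graph $G$ by two players, Blue (who has tokens) and White. All vertices of $G$ are initially white. Blue repeatedly applies one of the following rules until all vertices are blue. Rule 1: for one token, Blue can change any vertex from white to blue. Rule 2: at no cost, if a blue vertex $v$ of $G$ has exactly one white neighbor $w$, Blue may turn $w$ blue. Rule 3: let $B$ be the current set of blue vertices and let $W_1,\dots,W_k$ be the vertex sets of the connected components of $G[V(G)\setminus B]$. Blue selects at least $q+1$ of the $W_i$ and announces the selection to White (so this rule needs $k\ge q+1$). White then selects a nonempty subset $\{W_{i_1},\dots,W_{i_\ell}\}$ of the announced components and announces it back to Blue. At no cost, Blue can apply Rule 2 on the induced subgraph $G[B\cup W_{i_1}\cup\cdots\cup W_{i_\ell}]$.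 The $\operatorname{Z}_q$-forcing number $\operatorname{Z}_q(G)$ is the fewest number of tokens Blue must spend to color all of $G$ blue, under adversarial play by White. *)

(* Defs.v *)
From mathcomp Require Import all_boot.
From mathcomp Require Import boolp.

Set Implicit Arguments.
Unset Strict Implicit.
Unset Printing Implicit Defensive.

Section Graph.
Variables (V : finType) (e : rel V).

Definition simple_graph : Prop := symmetric e /\ irreflexive e.

(* In a simple graph a cycle has at least three vertices; an edge x -- y
   traversed back and forth is the ucycle [:: x; y] of size 2. *)
Definition is_tree : Prop :=
  [/\ simple_graph,
      forall x y, connect e x y
    & forall c : seq V, 2 < size c -> ~ ucycle e c].

Definition degree (v : V) : nat := #|[set u | e v u]|.

(* Length of a shortest path; the junk value #|V| is taken exactly when there
   is no path, which does not happen in a tree. *)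
Definition dist (x y : V) : nat :=
  find (fun n => [exists p : n.-tuple V, path e x p && (last x p == y)])
       (iota 0 #|V|).

Definition level (v : V) (l : nat) : {set V} := [set u | dist v u == l].

Definition height (v : V) : nat := \max_(u : V) dist v u.

Definition top_degrees (q : nat) (v : V) (l : nat) (L : {set V}) : Prop :=
  [/\ L \subset level v l,
      #|L| = minn q #|level v l|
    & forall a b, a \in L -> b \in level v l :\: L -> degree b <= degree a].

(* One application of Rule 2 in the induced subgraph G[A], where B \subset A
   is the set of blue vertices; B' is the resulting set of blue vertices. *)
Definition force_in (A B B' : {set V}) : Prop :=
  exists v w, [/\ v \in B, [set u in A :\: B | e v u] = [set w]
                & B' = w |: B].

Definition white_components (B : {set V}) : {set {set V}} :=
  equivalence_partition
    (connect [rel x y | [&& x \notin B, y \notin B & e x y]]) (~: B).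

(* [blue_wins q B k]: with blue set B, Blue has a strategy that colors all of
   V, whatever White does, spending at most k further tokens.  In Rule 3, Blue
   announces S, White answers with R, and [reply R] is the blue set after
   Blue's reaction: one application of Rule 2, or none.  Being inductive, the
   predicate only allows strategies that end after finitely many moves. *)
Inductive blue_wins (q : nat) : {set V} -> nat -> Prop :=
| blue_done k : blue_wins q setT k
| blue_rule1 (B : {set V}) k v :
    v \notin B -> blue_wins q (v |: B) k -> blue_wins q B k.+1
| blue_rule2 (B B' : {set V}) k :
    force_in setT B B' -> blue_wins q B' k -> blue_wins q B k
| blue_rule3 (B : {set V}) k (S : {set {set V}}) (reply : {set {set V}} -> {set V}) :
    S \subset white_components B -> q.+1 <= #|S| ->
    (forall R : {set {set V}}, R != set0 -> R \subset S ->
       reply R = B \/ force_in (B :|: cover R) B (reply R)) ->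
    (forall R : {set {set V}}, R != set0 -> R \subset S ->
       blue_wins q (reply R) k) ->
    blue_wins q B k.

Lemma blue_wins_tokens q (B : {set V}) : blue_wins q B #|~: B|.
Proof.
move: {2}#|~: B| (erefl #|~: B|) => n; elim: n B => [|n IHn] B cB.
  have -> : B = setT by rewrite -[B]setCK (cards0_eq cB) setC0.
  exact: blue_done.
have /card_gt0P[v vB] : 0 < #|~: B| by rewrite cB.
have cB' : #|~: (v |: B)| = n.
  by apply/eqP; rewrite setCU setIC -setDE -eqSS -cB [in X in _ == X](cardsD1 v) vB.
rewrite cB; apply: (@blue_rule1 _ _ _ v); first by rewrite in_setC in vB.
by rewrite -cB'; apply: IHn.
Qed.

Lemma blue_wins_ex q : exists k, `[< blue_wins q set0 k >].
Proof. by exists #|~: (set0 : {set V})|; apply/asboolP/blue_wins_tokens. Qed.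

Definition Zq (q : nat) : nat := ex_minn (blue_wins_ex q).

Lemma ZqP q :
  blue_wins q set0 (Zq q) /\ forall k, blue_wins q set0 k -> Zq q <= k.
Proof.
rewrite /Zq; case: ex_minnP => m /asboolP mP mmin.
by split=> // k kP; apply/mmin/asboolP.
Qed.

End Graph.

(* The minimum of F over a nonempty V: since nat has no top element, the fold
   starts from the maximum of F, which does not affect the result. *)
Definition min_over (V : finType) (F : V -> nat) : nat :=
  \big[minn / \max_(v : V) F v]_(v : V) F v.

Lemma min_over_le (V : finType) (F : V -> nat) v : min_over F <= F v.
Proof.
rewrite /min_over; move: (\max_(v : V) F v) => M.
have : v \in index_enum V by rewrite mem_index_enum.
elim: (index_enum V) => // x s IHs; rewrite inE big_cons.
by case/predU1P=> [<-|/IHs le]; rewrite geq_min ?leqnn // le orbT.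
Qed.

Lemma min_over_attained (V : finType) (F : V -> nat) :
  0 < #|V| -> exists v, min_over F = F v.
Proof.
move=> /(eq_bigmax F)[v0 Ev0]; rewrite /min_over Ev0.
elim/big_ind: _ => [|x y [u ->] [w ->]|v _]; [by exists v0| |by exists v].
by rewrite /minn; case: ifP => _; [exists u | exists w].
Qed.

(* Main.v *)
Require Import Defs.
From mathcomp Require Import all_boot.
Set Implicit Arguments.
Unset Strict Implicit.
Unset Printing Implicit Defensive.

(** Fix a root [v].  Blue colors [v] with one token and then its neighborhood:
    all neighbors but one cost a token each and the last one is forced, so that
    [degree e v] tokens are spent once the ball of radius 1 is blue.  It remains
    to advance from the ball of radius [l] to the ball of radius [l + 1], for
    [1 <= l < height e v], within the budget attached to the level [l].

    While more than [q] vertices at level [l] still have a white neighbor, Blue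
    picks one white neighbor of each and announces the white components of these
    picks.  As the graph is a tree and the blue set is connected, each white
    component is joined to the blue set by a single edge ([attachment_unique]).
    Hence the announced components are distinct, and whichever White returns,
    the blue end of the edge to a returned component has exactly one white
    neighbor there: a force is available, at no cost.  So Blue may
    assume that at most [q] vertices of level [l] have white neighbors
    ([thin_out]).  For each of them Blue spends tokens on all white neighbors but
    the last one and forces that one ([spend_and_force]).  Such a vertex [a]
    has a blue neighbor at level [l - 1], so that it costs at most
    [degree e a - 2] tokens, and the sum over at most [q] vertices of the level
    is bounded by the sum over the [q] vertices of largest degree
    ([leq_sum_top]). *)

(** * Sums over the largest values *)

(** The common part of [A] and [L] cancels; every value on [L :\: A] is at least
    the maximum over [A :\: L], and [L :\: A] is at least as large. *)
Lemma leq_sum_top (V : finType) (f : V -> nat) (S L A : {set V}) :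
  A \subset S -> #|A| <= #|L| ->
  (forall a b, a \in L -> b \in S :\: L -> f b <= f a) ->
  \sum_(a in A) f a <= \sum_(a in L) f a.
Proof.
move=> sAS leAL top.
rewrite (big_setID L) [leqRHS](big_setID A) /= setIC leq_add2l.
have leD : #|A :\: L| <= #|L :\: A|.
  by rewrite -(leq_add2l #|A :&: L|) cardsID setIC cardsID.
pose m := \max_(a in A :\: L) f a.
apply: (@leq_trans (#|A :\: L| * m)).
  rewrite -sum_nat_const; apply: leq_sum => a aA.
  exact: (leq_bigmax_cond (P := fun a => a \in A :\: L)).
apply: leq_trans (leq_mul leD (leqnn m)) _.
rewrite -sum_nat_const; apply: leq_sum => a; rewrite inE => /andP[_ aL].
apply/bigmax_leqP => b; rewrite inE => /andP[bL bA]; apply: top => //.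
by rewrite inE bL (subsetP sAS).
Qed.

(** * Distances in a connected graph *)

Section Distance.

Variables (V : finType) (e : rel V).
Hypothesis conn : forall x y, connect e x y.

(** The search defining [dist] only tries lengths below [#|V|]; removing the
    loops of a path brings its length below that bound. *)
Lemma dist_leP x y n :
  reflect (exists p, [/\ path e x p, last x p = y & size p <= n])
          (dist e x y <= n).
Proof.
rewrite /dist; set a := (X in find X).
have found p : path e x p -> last x p = y ->
    find a (iota 0 #|V|) <= size p /\ find a (iota 0 #|V|) < #|V|.
  case/shortenP=> p' e_p' uniq_p' sub_p lastp.
  have le_p : size p' <= size p by case/andP: (uniq_p') => _ /uniq_leq_size->.
  have ltV : size p' < #|V|.
    by rewrite -[(size p').+1]/(size (x :: p')) -(card_uniqP uniq_p') max_card.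
  suff le_find : find a (iota 0 #|V|) <= size p'.
    by split; [apply: leq_trans le_find le_p | apply: leq_ltn_trans le_find ltV].
  rewrite leqNgt; apply/negP => /(before_find 0); rewrite nth_iota // add0n => /negbT/existsPn.
  by move=> /(_ (in_tuple p'))/negP[]; rewrite /= e_p' lastp eqxx.
apply: (iffP idP) => [le_n|[p [e_p lastp le_n]]]; last first.
  by apply: leq_trans le_n; case: (found p e_p lastp).
have /connectP[p0 e_p0 lastp0] := conn x y.
have [_ ltV] := found p0 e_p0 (esym lastp0).
have /existsP[p /andP[e_p /eqP lastp]] : a (find a (iota 0 #|V|)).
  rewrite -{1}[find _ _]add0n -(nth_iota 0 0 ltV); apply: nth_find.
  by rewrite has_find size_iota.
by exists p; rewrite size_tuple.
Qed.

Lemma dist_eq0 x y : (dist e x y == 0) = (y == x).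
Proof.
rewrite -leqn0; apply/dist_leP/eqP => [[[|z p] [_ <- _]]|->] //.
by exists [::].
Qed.

Lemma dist_edge v x y : e x y -> dist e v y <= (dist e v x).+1.
Proof.
move=> e_xy; have /dist_leP[p [e_p lastp le_p]] := leqnn (dist e v x).
apply/dist_leP; exists (rcons p y).
by rewrite rcons_path last_rcons size_rcons e_p lastp e_xy.
Qed.

Lemma dist_pred v y n : dist e v y = n.+1 -> exists2 x, e x y & dist e v x = n.
Proof.
move=> d_y; have /dist_leP[p] := leqnn (dist e v y).
rewrite d_y; case/lastP: p => [[_ /= Evy _]|p z].
  by move: (dist_eq0 v y); rewrite d_y Evy eqxx.
rewrite rcons_path last_rcons size_rcons => -[/andP[e_p e_z] Ez le_p].
exists (last v p); rewrite -?Ez //; apply/eqP; rewrite eqn_leq; apply/andP; split.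
  by apply/dist_leP; exists p.
by rewrite -ltnS -d_y -Ez dist_edge.
Qed.

End Distance.

(** * White components of a tree with a connected blue set *)

Section Attachment.

Variables (V : finType) (e : rel V).

Definition rel_in (A : {set V}) : rel V :=
  [rel x y | [&& x \in A, y \in A & e x y]].

Definition connected_in (B : {set V}) : Prop :=
  {in B &, forall x y, connect (rel_in B) x y}.

Lemma connect_rel_inW (A B : {set V}) x y :
  A \subset B -> connect (rel_in A) x y -> connect (rel_in B) x y.
Proof.
move=> sAB; apply: connect_sub => a b /= /and3P[aA bA e_ab].
by apply: connect1; apply/and3P; rewrite !(subsetP sAB).
Qed.

Hypothesis treeP : is_tree e.

Let symE : symmetric e. Proof. by case: treeP => -[]. Qed.
Let irrE : irreflexive e. Proof. by case: treeP => -[]. Qed.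

Lemma rel_in_sym A : symmetric (rel_in A).
Proof. by move=> x y; rewrite /rel_in /= andbCA symE. Qed.

Lemma path_rel_in A x p : path (rel_in A) x p -> {subset p <= A}.
Proof.
elim: p x => //= y p IHp x /andP[/and3P[_ yA _] /IHp sp] z.
by rewrite inE => /predU1P[->|/sp].
Qed.

(** This is how acyclicity is used: a simple path from [a] to [b] avoiding [x]
    would close up to a cycle through [x]. *)
Lemma neighbors_separated x a b :
  e x a -> e x b -> connect (rel_in [set~ x]) a b -> a = b.
Proof.
move=> e_xa e_xb /connectP[p0 /shortenP[[|c p] e_p uniq_p _] Eb] => //.
case: treeP => _ _ /(_ [:: x, a, c & p] isT) []; apply/andP; split; last first.
  rewrite cons_uniq uniq_p andbT inE negb_or.
  apply/andP; split; first by apply: contraTneq e_xa => <-; rewrite irrE.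
  by apply/negP => /(path_rel_in e_p); rewrite !inE eqxx.
suff : path e x (rcons (a :: c :: p) x) by [].
have e_xacp : path e x (a :: c :: p).
  by apply/andP; split=> //; apply: sub_path e_p => y z /and3P[].
by rewrite rcons_path e_xacp -[last _ _]/(last a (c :: p)) -Eb symE e_xb.
Qed.

(** If [w1] and [w2] differ, let [x] be the vertex after [w1] on a simple white
    path to [w2]: continuing to [w2] and back through the blue set joins [x] to
    [b1] without meeting [w1], although both are neighbors of [w1] and only [b1]
    is blue.  Once [w1 = w2], its neighbors [b1] and [b2] are joined by a path
    inside the blue set. *)
Lemma attachment_unique (B : {set V}) b1 b2 w1 w2 :
  connected_in B -> b1 \in B -> b2 \in B -> w1 \notin B -> w2 \notin B ->
  e b1 w1 -> e b2 w2 -> connect (rel_in (~: B)) w1 w2 -> w1 = w2 /\ b1 = b2.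
Proof.
move=> connB b1B b2B w1B w2B e1 e2 w12.
have sB w : w \notin B -> B \subset [set~ w].
  by move=> wB; apply/subsetP => z zB; rewrite !inE; apply: contraNneq wB => <-.
have b21 : connect (rel_in [set~ w1]) b2 b1.
  by apply: connect_rel_inW (sB _ w1B) _; apply: connB.
suff Ew : w1 = w2.
  split=> //; subst w2; apply/esym/(@neighbors_separated w1) => //; by rewrite symE.
case/connectP: w12 => p0 /shortenP[[|x p] e_p uniq_p _] Ew2 //.
have xB : x \notin B by case/andP: e_p => /and3P[_ + _ _]; rewrite inE.
suff Ex : x = b1 by rewrite Ex b1B in xB.
apply: (@neighbors_separated w1); first by case/andP: e_p => /and3P[].
  by rewrite symE.
apply: connect_trans b21.
have w1p z : z \in x :: p -> z != w1.
  by case/andP: uniq_p => w1p _ zp; apply: contraNneq w1p => <-.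
have w21 : w2 != w1 by rewrite Ew2 w1p //= mem_last.
apply: (@connect_trans _ _ w2); last first.
  apply: connect1; rewrite /rel_in /= !inE w21 symE e2 andbT.
  by apply: contraNneq w1B => <-.
apply/connectP; exists p => //.
case/andP: e_p => _; elim: p x w1p {Ew2 uniq_p xB} => //= y p IHp x w1p /andP[/and3P[_ _ e_xy] e_p].
apply/andP; split.
  by apply/and3P; split=> //; rewrite !inE w1p ?inE ?eqxx ?orbT.
by apply: IHp e_p => z zp; apply: w1p; rewrite inE zp orbT.
Qed.

Lemma connected_in_add (B : {set V}) a w :
  connected_in B -> a \in B -> e a w -> connected_in (w |: B).
Proof.
move=> connB aB e_aw.
have sB : B \subset w |: B by apply: subsetUr.
have toA x : x \in w |: B -> connect (rel_in (w |: B)) x a.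
  rewrite 2!inE => /predU1P[->|xB]; last exact: connect_rel_inW sB (connB _ _ xB aB).
  by apply: connect1; rewrite /rel_in /= !inE eqxx aB orbT symE.
move=> x y xB yB; apply: connect_trans (toA x xB) _.
by rewrite (sym_connect_sym (@rel_in_sym _)) toA.
Qed.

End Attachment.

(** * Strategies that color a neighborhood *)

Section Strategy.

Variables (V : finType) (e : rel V) (q : nat).

Definition nbhd (U : {set V}) : {set V} := [set w | [exists a in U, e a w]].

Definition white_nbrs (B : {set V}) (a : V) : {set V} := [set w in ~: B | e a w].

Lemma blue_wins_leq (B : {set V}) j k :
  blue_wins e q B j -> j <= k -> blue_wins e q B k.
Proof.
move=> win_j; elim: win_j k => {B j} [j|B j v vB _ IH|B B' j fB _ IH|B j S reply sS cS rP _ IH] k.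
- by move=> _; apply: blue_done.
- by case: k => // k /IH; apply: blue_rule1.
- by move=> /IH; apply: blue_rule2.
- by move=> le_jk; apply: blue_rule3 rP _ => // R R0 sR; apply: IH.
Qed.

Lemma white_nbrsS (B B' : {set V}) a :
  B \subset B' -> white_nbrs B' a \subset white_nbrs B a.
Proof.
move=> sB; apply/subsetP => w; rewrite !inE => /andP[wB' ->]; rewrite andbT.
by apply: contra wB'; apply: (subsetP sB).
Qed.

Lemma nbhd_add (B U : {set V}) w :
  w \in nbhd U -> (w |: B) :|: nbhd U = B :|: nbhd U.
Proof.
by move=> wU; rewrite -setUA setUCA; congr (_ :|: _); apply/setUidPr; rewrite sub1set.
Qed.

(** The vertices of [A] are treated one white neighbor at a time.  The sum counts,
    for each vertex, all its white neighbors but one (truncated subtraction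
    makes finished vertices free), so it drops by at least one with each token spent,
    and coloring a vertex never increases it. *)
Lemma spend_and_force (A B : {set V}) k :
  A \subset B -> blue_wins e q (B :|: nbhd A) k ->
  blue_wins e q B (\sum_(a in A) (#|white_nbrs B a| - 1) + k).
Proof.
have [n] := ubnP #|~: B|; elim: n B k => // n IHn B k cB sAB win.
have [/exists_inP[a aA /set0Pn[w wa]]|all0] :=
  boolP [exists a in A, white_nbrs B a != set0]; last first.
  suff EB : B :|: nbhd A = B by rewrite EB in win; apply: blue_wins_leq win (leq_addl _ _).
  apply/setUidPl/subsetP => w; rewrite inE => /exists_inP[a aA e_aw].
  apply: contraNT all0 => wB; apply/exists_inP; exists a => //.
  by apply/set0Pn; exists w; rewrite !inE wB.
have [wB e_aw] : w \notin B /\ e a w by move: wa; rewrite !inE => /andP[].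
have cB' : #|~: (w |: B)| < n.
  rewrite -ltnS; apply: leq_trans cB; rewrite ltnS setCU setIC -setDE.
  by rewrite [leqRHS](cardsD1 w) inE wB.
have win' : blue_wins e q ((w |: B) :|: nbhd A) k.
  by rewrite nbhd_add // inE; apply/exists_inP; exists a.
have {}win' := IHn _ _ cB' (subset_trans sAB (subsetUr _ _)) win'.
have le_sub b : #|white_nbrs (w |: B) b| - 1 <= #|white_nbrs B b| - 1.
  by apply/leq_sub2r/subset_leq_card/white_nbrsS/subsetUr.
have [one|many] := leqP #|white_nbrs B a| 1.
  apply: (@blue_rule2 _ _ _ _ (w |: B)).
    exists a, w; split=> //; first exact: subsetP sAB a aA.
    have <- : white_nbrs B a = [set w].
      by apply/esym/eqP; rewrite eqEcard sub1set wa cards1.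
    by apply/setP => u; rewrite !inE andbT.
  by apply: blue_wins_leq win' _; rewrite leq_add2r leq_sum.
apply: (@blue_wins_leq _ (\sum_(b in A) (#|white_nbrs (w |: B) b| - 1) + k).+1).
  exact: blue_rule1 win'.
rewrite -addSn leq_add2r (bigD1 a) //= [ltnRHS](bigD1 a) //= -addSn.
apply: leq_add; last by apply: leq_sum.
suff lt : #|white_nbrs (w |: B) a| < #|white_nbrs B a|.
  by rewrite ltn_subRL; case: #|white_nbrs (w |: B) a| lt => //= m; rewrite subSS subn0.
apply: proper_card; apply/properP; split; first exact/white_nbrsS/subsetUr.
by exists w => //; rewrite !inE eqxx.
Qed.

Hypothesis treeP : is_tree e.

(** As long as more than [q] vertices of [U] have white neighbors, announcing by
    Rule 3 one component next to each of them yields a free force inside the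
    neighborhood of [U].  The new blue vertex is adjacent to a blue one, so the blue set stays
    connected and the process can be repeated. *)
Lemma thin_out (U B : {set V}) k :
  connected_in e B -> U \subset B ->
  (forall B' : {set V}, B \subset B' -> B' :|: nbhd U = B :|: nbhd U ->
     #|[set a in U | white_nbrs B' a != set0]| <= q -> blue_wins e q B' k) ->
  blue_wins e q B k.
Proof.
have [n] := ubnP #|~: B|; elim: n B => // n IHn B cB connB sUB win.
set act := [set a in U | white_nbrs B a != set0].
have [few|many] := leqP #|act| q; first exact: win.
pose ch a := odflt a [pick w in white_nbrs B a].
have chP a : a \in act -> [/\ a \in U, ch a \notin B & e a (ch a)].
  rewrite inE => /andP[aU /set0Pn[w wa]]; rewrite /ch.
  by case: pickP => [u|/(_ w)]; rewrite ?wa // !inE => /andP[].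
have inB a : a \in act -> a \in B by case/chP => aU _ _; apply: (subsetP sUB).
pose white := [rel x y | [&& x \notin B, y \notin B & e x y]].
have whiteE : connect white =2 connect (rel_in e (~: B)).
  by apply: eq_connect => x y; rewrite /rel_in /= !inE.
pose comp a := [set y in ~: B | connect white (ch a) y].
have compP a b w : a \in act -> b \in act -> w \in comp b -> e a w ->
    w = ch a /\ a = b.
  move=> aA bA; rewrite !inE whiteE => /andP[wB con] e_aw.
  have [_ chbB e_b] := chP b bA.
  have [Ew Eab] :=
    attachment_unique treeP connB (inB b bA) (inB a aA) chbB wB e_b e_aw con.
  by rewrite -Eab Ew.
have ch_comp a : a \in act -> ch a \in comp a.
  by case/chP => _ chB _; rewrite !inE chB connect0.
have comp_inj : {in act &, injective comp}.
  move=> a b aA bA Eab; have [_ _ e_a] := chP a aA.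
  by case: (compP a b (ch a)); rewrite -?Eab ?ch_comp.
(* White's answer contains the component attached to some [a] in [act], which then
   forces its chosen neighbor; [B] is a junk value. *)
pose reply (R : {set {set V}}) :=
  if [pick a in act | comp a \in R] is Some a then ch a |: B else B.
have replyP R : R != set0 -> R \subset comp @: act ->
    exists2 a, a \in act /\ comp a \in R & reply R = ch a |: B.
  move=> /set0Pn[C CR] /subsetP/(_ C CR)/imsetP[a aA EC]; rewrite /reply.
  case: pickP => [b /andP[bA bR]|/(_ a)]; first by exists b.
  by rewrite aA -EC CR.
apply: (@blue_rule3 _ _ _ _ _ (comp @: act) reply).
- apply/subsetP => C /imsetP[a aA ->]; apply: imset_f.
  by rewrite inE; case: (chP a aA).
- by rewrite card_in_imset.
- move=> R R0 sR; right; have [a [aA aR] ->] := replyP R R0 sR.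
  have [_ chB e_a] := chP a aA.
  exists a, (ch a); split=> //; first exact: inB.
  apply/setP => u; rewrite !inE; apply/idP/eqP => [|->]; last first.
    have -> : ch a \in cover R by apply/bigcupP; exists (comp a); rewrite ?ch_comp.
    by rewrite e_a chB orbT.
  case/andP=> /andP[uB]; rewrite (negPf uB) => /bigcupP[C CR uC] e_au.
  have /imsetP[b bA EC] := subsetP sR C CR.
  by case: (compP a b u); rewrite -?EC.
move=> R R0 sR; have [a [aA _] ->] := replyP R R0 sR.
have [aU chB e_a] := chP a aA.
have chU : ch a \in nbhd U by rewrite inE; apply/exists_inP; exists a.
have sB : B \subset ch a |: B := subsetUr _ _.
apply: IHn.
- rewrite -ltnS; apply: leq_trans cB; rewrite ltnS setCU setIC -setDE.
  by rewrite [leqRHS](cardsD1 (ch a)) inE chB.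
- exact: connected_in_add (inB a aA) e_a.
- exact: subset_trans sUB sB.
- move=> B' sB' EB'; apply: win; first exact: subset_trans sB sB'.
  by rewrite EB' nbhd_add.
Qed.

(** White decides which vertices of [U] survive [thin_out], so the budget [c] has
    to cover every set of at most [q] vertices of [U].  White neighbors are
    counted before any move because coloring can only decrease their number. *)
Lemma advance (U B : {set V}) c k :
  connected_in e B -> U \subset B ->
  (forall A : {set V}, A \subset U -> #|A| <= q ->
     \sum_(a in A) (#|white_nbrs B a| - 1) <= c) ->
  blue_wins e q (B :|: nbhd U) k -> blue_wins e q B (c + k).
Proof.
move=> connB sUB cP win; apply: (thin_out connB sUB) => // B' sB EB'.
set act := [set a in U | _] => few.
have sAU : act \subset U by apply/subsetP => a; rewrite inE => /andP[].
have Eact : B' :|: nbhd act = B :|: nbhd U.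
  rewrite -EB'; apply/setP => w; rewrite !inE; case wB': (w \in B') => //=.
  apply/exists_inP/exists_inP => -[a aA e_aw]; exists a => //.
    exact: (subsetP sAU).
  by rewrite inE aA; apply/set0Pn; exists w; rewrite !inE wB'.
rewrite -Eact in win.
apply: blue_wins_leq (spend_and_force _ win) _.
  exact: subset_trans sAU (subset_trans sUB sB).
rewrite leq_add2r; apply: leq_trans (cP _ sAU few); apply: leq_sum => a _.
exact/leq_sub2r/subset_leq_card/white_nbrsS.
Qed.

End Strategy.

(** * Balls around the root *)

Section Levels.

Variables (V : finType) (e : rel V).
Hypothesis treeP : is_tree e.
Variable v : V.

Let conn : forall x y, connect e x y. Proof. by case: treeP. Qed.
Let symE : symmetric e. Proof. by case: treeP => -[]. Qed.

Definition ball (l : nat) : {set V} := [set u | dist e v u <= l].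

Lemma ball0 : ball 0 = [set v].
Proof. by apply/setP => u; rewrite !inE leqn0 dist_eq0. Qed.

Lemma level0 : level e v 0 = [set v].
Proof. by apply/setP => u; rewrite !inE dist_eq0. Qed.

Lemma ball_height : ball (height e v) = setT.
Proof. by apply/setP => u; rewrite !inE; apply: leq_bigmax. Qed.

Lemma level_ball l : level e v l \subset ball l.
Proof. by apply/subsetP => u; rewrite !inE => /eqP->. Qed.

Lemma ballS l : ball l.+1 = ball l :|: nbhd e (level e v l).
Proof.
apply/setP => u; rewrite !inE leq_eqVlt ltnS orbC; case: leqP => //= lt_lu.
apply/eqP/exists_inP => [/(dist_pred conn)[x e_xu d_x]|[x]].
  by exists x => //; rewrite inE d_x.
rewrite inE => /eqP d_x /(dist_edge conn v); rewrite d_x => le_u.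
by apply/eqP; rewrite eqn_leq le_u.
Qed.

Lemma connected_in_ball l : connected_in e (ball l).
Proof.
have toV x : x \in ball l -> connect (rel_in e (ball l)) x v.
  have [n] := ubnP (dist e v x); elim: n x => // n IHn x lt_n xl.
  case d_x: (dist e v x) => [|d].
    by move/eqP: d_x; rewrite dist_eq0 // => /eqP->.
  have [y e_yx d_y] := dist_pred conn d_x.
  have yl : y \in ball l by move: xl; rewrite !inE d_y d_x => /ltnW.
  apply: (@connect_trans _ _ y); first by apply: connect1; rewrite /rel_in /= xl yl symE.
  by apply: IHn; rewrite // d_y -ltnS -d_x.
move=> x y xl yl; apply: connect_trans (toV x xl) _.
by rewrite (sym_connect_sym (rel_in_sym treeP _)) toV.
Qed.

(** The strict inequality comes from a neighbor one level below, which is blue. *)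
Lemma white_nbrs_ball l a :
  a \in level e v l.+1 -> #|white_nbrs e (ball l.+1) a| < degree e a.
Proof.
rewrite inE => /eqP/(dist_pred conn)[x e_xa d_x]; apply: proper_card.
apply/properP; split; first by apply/subsetP => u; rewrite !inE => /andP[].
by exists x; rewrite !inE ?d_x ?leqnSn // symE.
Qed.

End Levels.

(** * The bound *)

Theorem theorem3p4 (q : nat) (V : finType) (e : rel V)
    (L : V -> nat -> {set V})
    (treeP : is_tree e) (cardV : 2 <= #|V|)
    (LP : forall v l, top_degrees e q v l (L v l)) :
  Zq e q <= min_over (fun v : V =>
    degree e v +
    \sum_(1 <= l < height e v) \sum_(a in L v l) maxn 0 (degree e a - 2)).
Proof.
have V0 : 0 < #|V| by apply: ltnW.
set F := (X in min_over X); have [v ->] := min_over_attained F V0; rewrite {}/F.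
case: (ZqP e q) => _; apply.
have conn : forall x y, connect e x y by case: treeP.
have [w wv] : exists w, w != v.
  have : 0 < #|[set~ v]| by rewrite cardsC1 -subn1 subn_gt0.
  by case/card_gt0P => w; rewrite !inE; exists w.
have h_gt0 : 0 < height e v.
  by apply: leq_trans (leq_bigmax w); rewrite lt0n dist_eq0.
have deg_gt0 : 0 < degree e v.
  case/connectP: (conn v w) wv => -[|x p] /= e_p ->; rewrite ?eqxx // => _.
  by apply/card_gt0P; exists x; rewrite inE; case/andP: e_p.
have climb l : 0 < l <= height e v ->
    blue_wins e q (ball e v l)
      (\sum_(l <= i < height e v) \sum_(a in L v i) maxn 0 (degree e a - 2)).
  move=> /andP[]; have [n] := ubnP (height e v - l).
  elim: n l => // n IHn l lt_n l_gt0; rewrite leq_eqVlt => /predU1P[->|lt_lh].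
    by rewrite ball_height; apply: blue_done.
  rewrite big_ltn //; apply: (@advance _ _ _ treeP (level e v l)).
  - exact: connected_in_ball.
  - exact: level_ball.
  - move=> A sA le_A; have [_ cardL topL] := LP v l.
    apply: (@leq_trans (\sum_(a in A) (degree e a - 2))).
      case: l l_gt0 sA {IHn lt_n lt_lh le_A cardL topL} => // l _ /subsetP sA.
      apply: leq_sum => a /sA/(white_nbrs_ball treeP) lt_a.
      by rewrite -[2]/(1 + 1) subnDA leq_sub2r // subn1 -ltnS (ltn_predK lt_a).
    rewrite (eq_bigr _ (fun a _ => max0n _)).
    apply: (leq_sum_top sA); first by rewrite cardL leq_min le_A subset_leq_card.
    by move=> a b aL bL; apply/leq_sub2r/topL.
  - by rewrite -ballS //; apply: IHn => //; rewrite subnS prednK ?subn_gt0.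
(* One of the [degree e v] tokens pays for the root, the others for all its
   neighbors but one. *)
rewrite -(prednK deg_gt0) addSn; apply: (@blue_rule1 _ _ _ _ _ v).
  by rewrite inE.
rewrite setU0.
have force_last : blue_wins e q [set v]
    (\sum_(a in [set v]) (#|white_nbrs e [set v] a| - 1) +
     \sum_(1 <= i < height e v) \sum_(a in L v i) maxn 0 (degree e a - 2)).
  apply: spend_and_force => //.
  rewrite -{2}(level0 treeP) -(ball0 treeP) -ballS //.
  exact: climb.
apply: blue_wins_leq force_last _.
rewrite big_set1 leq_add2r subn1 -!subn1 leq_sub2r // subset_leq_card //.
by apply/subsetP => u; rewrite !inE => /andP[].
Qed.
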